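(* Consider a shape-morphing approximate solution of the form $$\hat u(\mathbf x,\mathbf q)=\sum_{i=1}^{r}\alpha_i\,\phi(\mathbf x,\boldsymbol\beta_i),\qquad \alpha_i\in\mathbb R,\ \boldsymbol\beta_i\in\mathbb R^{K-1},\qquad \mathbf q=(\alpha_1,\boldsymbol\beta_1^\top,\dots,\alpha_r,\boldsymbol\beta_r^\top)^\top\in\mathbb R^{rK}.$$ Forming the metric tensor $M(\mathbf q)\in\mathbb R^{rK\times rK}$ and the right-hand side vector $\mathbf f(\mathbf q)\in\mathbb R^{rK}$ requires the symbolic calculation of $K(K+3)/2$ inner products (in the sense of symbolic calculation specified in the context: all entries of $M$ and $\mathbf f$ are obtained from $K(K+3)/2$ symbolic inner products by substitution). This number of symbolic computations is independent of the number of modes $r$ used in the approximate solution.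
   Context: Setting: $H$ is a real Hilbert space of functions on a spatial domain $D\subseteq\mathbb R^d$, with inner product $\langle\cdot,\cdot\rangle_H$. $F$ is a (possibly nonlinear) differential operator, the right-hand side of the PDE $\partial u/\partial t=F(u)$. The functions $\phi(\cdot,\boldsymbol\beta):\mathbb R^d\to\mathbb R$, $\boldsymbol\beta\in\mathbb R^{K-1}$, are $C^1$, and it is understood that $\phi$ is differentiable in $\boldsymbol\beta$ and that $\partial\hat u/\partial q_i$ and $F(\hat u)$ belong to $H$. The scalar $\alpha_i$ is the amplitude of the $i$-th mode and $\boldsymbol\beta_i=(\beta_{i1},\dots,\beta_{i(K-1)})^\top$ are its shape parameters; $K$ does not depend on $r$. The total number of parameters is $n=rK$. The metric tensor and right-hand side vector are $$M_{ij}(\mathbf q)=\Big\langle\frac{\partial\hat u}{\partial q_i},\frac{\partial\hat u}{\partial q_j}\Big\rangle_H,\qquad f_i(\mathbf q)=\Big\langle\frac{\partial\hat u}{\partial q_i},F(\hat u)\Big\rangle_H,\qquad i,j\in\{1,\dots,n\}.$$ Meaning of ''symbolic calculation''. Write $\theta_i=(\alpha_i,\boldsymbol\beta_i)\in\mathbb R^K$ for the parameters of the $i$-th mode, with components $\theta_{i,1}=\alpha_i$ and $\theta_{i,k+1}=\beta_{ik}$ for $k=1,\dots,K-1$. One symbolic calculation consists of obtaining one expression of one of the two following kinds, for generic mode indices $i,j$ (that is, as a function of the symbolic parameters): (1) $\big\langle\partial\hat u/\partial\theta_{i,a},\,\partial\hat u/\partial\theta_{j,b}\big\rangle_H$ for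 one fixed pair $(a,b)\in\{1,\dots,K\}^2$, as a function $G_{ab}(\theta_i,\theta_j)$ of the parameters of two generic modes; (2) $\big\langle\partial\hat u/\partial\theta_{i,a},\,F(\hat u)\big\rangle_H$ for one fixed $a\in\{1,\dots,K\}$, as a function $h_a(\theta_i;\mathbf q)$ of the parameters of a generic mode and of $\mathbf q$. Once an expression has been obtained, evaluating it by substituting any parameter values (including interchanging the roles of the two modes in (1)) does not count as a further symbolic calculation. The statement thus asserts that $K(K+3)/2$ such expressions suffice to obtain every entry of $M(\mathbf q)$ and every entry of $\mathbf f(\mathbf q)$ by substitution, whatever $r$ is. *)

(* Defs.v *)
From mathcomp Require Import all_boot all_order all_algebra.
From mathcomp Require Import all_classical all_reals all_analysis.

Set Implicit Arguments.
Unset Strict Implicit.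
Unset Printing Implicit Defensive.

Import Order.TTheory GRing.Theory Num.Theory.
Import numFieldNormedType.Exports.

Local Open Scope classical_set_scope.
Local Open Scope ring_scope.

(* A real Hilbert space of functions on X.  The functions belonging to the space
   form a linear subspace [hfs_mem] of X -> R; [hfs_class] sends such a function
   to the vector it represents.  [hfs_class] is not required to be injective on
   [hfs_mem], so that spaces of classes modulo a.e. equality (L^2, Sobolev
   spaces) are covered as well as spaces of genuine functions.  Outside
   [hfs_mem] the value of [hfs_class] is meaningless. *)
Record hilbert_function_space (R : realType) (X : Type) := HilbertFunctionSpace {
  hfs_space : completeNormedModType R;
  hfs_dot : hfs_space -> hfs_space -> R;
  hfs_dotC : forall v w, hfs_dot v w = hfs_dot w v;
  hfs_dot_linear : forall a v v' w,
    hfs_dot (a *: v + v') w = a * hfs_dot v w + hfs_dot v' w;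
  hfs_dot_norm : forall v, hfs_dot v v = `|v| ^+ 2;
  hfs_mem : set (X -> R);
  hfs_class : (X -> R) -> hfs_space;
  hfs_mem0 : hfs_mem (fun=> 0);
  hfs_mem_linear : forall a f g, hfs_mem f -> hfs_mem g ->
    hfs_mem (fun x => a * f x + g x);
  hfs_class_linear : forall a f g, hfs_mem f -> hfs_mem g ->
    hfs_class (fun x => a * f x + g x) = a *: hfs_class f + hfs_class g;
  hfs_class_surj : forall v, exists2 f, hfs_mem f & hfs_class f = v
}.

Definition hfs_inner (R : realType) (X : Type)
    (H : hilbert_function_space R X) (f g : X -> R) : R :=
  hfs_dot (hfs_class H f) (hfs_class H g).

Definition partial (R : realType) (n : nat) (i : 'I_n) (f : 'rV[R]_n -> R)
    (x : 'rV[R]_n) : R :=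
  'D_(delta_mx 0 i) f x.

Definition iter_partial (R : realType) (n : nat) (w : seq 'I_n)
    (f : 'rV[R]_n -> R) : 'rV[R]_n -> R :=
  foldr (@partial R n) f w.

Definition C1 (R : realType) (n : nat) (f : 'rV[R]_n -> R) : Prop :=
  (forall x, differentiable f x) /\ (forall i, continuous (partial i f)).

(* [F u x] is a possibly nonlinear function [Phi] of x and of the partial
   derivatives of u at x up to some order m.  [partial] is total: where a
   derivative does not exist it takes an unspecified value, and so does [F u]. *)
Definition differential_operator (R : realType) (d : nat) (D : set 'rV[R]_d)
    (F : ('rV[R]_d -> R) -> (D -> R)) : Prop :=
  exists (m : nat) (Phi : D -> (seq 'I_d -> R) -> R), forall u x,
    F u x = Phi x (fun w => if (size w <= m)%N
                            then iter_partial w u (set_val x) else 0).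

(* Throughout, p = K - 1 is the number of shape parameters of a mode, so that
   K = p.+1.  A mode theta = (alpha, beta) is a vector of 'rV_p.+1, and
   q : 'rV_(r * p.+1) is the concatenation of its r modes. *)

Definition amplitude (R : realType) (p : nat) (theta : 'rV[R]_p.+1) : R :=
  theta 0 ord0.

Definition shape (R : realType) (p : nat) (theta : 'rV[R]_p.+1) : 'rV[R]_p :=
  \row_k theta 0 (lift ord0 k).

Definition mode (R : realType) (p r : nat) (q : 'rV[R]_(r * p.+1)) (i : 'I_r)
    : 'rV[R]_p.+1 :=
  row i (vec_mx q).

Section ShapeMorphing.
Context (R : realType) (d p : nat) (D : set 'rV[R]_d).
Context (H : hilbert_function_space R D).
Context (F : ('rV[R]_d -> R) -> (D -> R)).
Context (phi : 'rV[R]_d -> 'rV[R]_p -> R).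

Definition uhat (r : nat) (q : 'rV[R]_(r * p.+1)) (x : 'rV[R]_d) : R :=
  \sum_(i < r) amplitude (mode q i) * phi x (shape (mode q i)).

Definition duhat (r : nat) (q : 'rV[R]_(r * p.+1)) (i : 'I_(r * p.+1))
    (x : D) : R :=
  partial i (fun q' => uhat q' (set_val x)) q.

Definition metric (r : nat) (q : 'rV[R]_(r * p.+1)) : 'M[R]_(r * p.+1) :=
  \matrix_(i, j) hfs_inner H (duhat q i) (duhat q j).

Definition rhs (r : nat) (q : 'rV[R]_(r * p.+1)) : 'cV[R]_(r * p.+1) :=
  \col_i hfs_inner H (duhat q i) (F (uhat q)).

(* The outcome of one symbolic calculation: the expression G_ab(theta, theta')
   of the inner product of du/dtheta_{i,a} and du/dtheta_{j,b}, or the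
   expression h_a(theta; q) of the inner product of du/dtheta_{i,a} and F(u).
   An expression does not mention the number of modes r, except that h_a may
   be evaluated at a parameter vector q having any number of modes. *)
Inductive symbolic_calculation : Type :=
| SymMetric (a b : 'I_p.+1) (G : 'rV[R]_p.+1 -> 'rV[R]_p.+1 -> R)
| SymRhs (a : 'I_p.+1) (h : 'rV[R]_p.+1 -> forall r, 'rV[R]_(r * p.+1) -> R).

(* [mxvec_index i a] is the position in q of the a-th parameter of mode i. *)
Definition correct_calculation (c : symbolic_calculation) : Prop :=
  match c with
  | SymMetric a b G => forall r (q : 'rV[R]_(r * p.+1)) (i j : 'I_r),
      hfs_inner H (duhat q (mxvec_index i a)) (duhat q (mxvec_index j b))
      = G (mode q i) (mode q j)
  | SymRhs a h => forall r (q : 'rV[R]_(r * p.+1)) (i : 'I_r),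
      hfs_inner H (duhat q (mxvec_index i a)) (F (uhat q))
      = h (mode q i) r q
  end.

(* The modes that are substituted depend on the entry but not on q. *)
Definition yields_metric_entry (c : symbolic_calculation) (r : nat)
    (i j : 'I_(r * p.+1)) : Prop :=
  match c with
  | SymMetric _ _ G => exists k l : 'I_r, forall q : 'rV[R]_(r * p.+1),
      metric q i j = G (mode q k) (mode q l)
  | SymRhs _ _ => False
  end.

Definition yields_rhs_entry (c : symbolic_calculation) (r : nat)
    (i : 'I_(r * p.+1)) : Prop :=
  match c with
  | SymMetric _ _ _ => False
  | SymRhs _ h => exists k : 'I_r, forall q : 'rV[R]_(r * p.+1),
      rhs q i 0 = h (mode q k) r q
  end.

End ShapeMorphing.

(* Main.v *)
Require Import Defs.
From mathcomp Require Import all_boot all_order all_algebra.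
From mathcomp Require Import all_classical all_reals all_analysis.
From mathcomp Require Import zify.
Import GRing.Theory.
Import numFieldNormedType.Exports.
Local Open Scope classical_set_scope.
Local Open Scope ring_scope.

(** The approximate solution is a sum of terms, one for each mode, all given by
    the same function [mode_term] of the parameters of the mode.  Moving the
    [a]-th parameter of mode [i] changes the [i]-th term only, so the derivative
    of the sum in this parameter is the derivative of [mode_term] in its [a]-th
    variable, at the parameters of mode [i] ([duhat_mxvec_index]).  It is
    therefore one expression, in which neither [i] nor [r] occurs.

    Hence an entry of the metric at positions [(i, a)] and [(j, b)] is a
    function G_ab of the modes [i] and [j], and an entry of the right-hand side
    at [(i, a)] is a function h_a of the mode [i] and of [q].  As the inner
    product is symmetric, G_ba is G_ab with its two modes interchanged, so the
    pairs with [a <= b] suffice: with K = p.+1 they are K (K + 1) / 2, and the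
    K functions h_a bring the total to K (K + 3) / 2
    ([card_calculation_index]). *)

Set Implicit Arguments.
Unset Strict Implicit.
Unset Printing Implicit Defensive.

Section OneMode.
Context (R : realType) (d p : nat) (D : set 'rV[R]_d).
Context (phi : 'rV[R]_d -> 'rV[R]_p -> R).

Definition mode_term (x : 'rV[R]_d) (theta : 'rV[R]_p.+1) : R :=
  amplitude theta * phi x (Defs.shape theta).

Definition mode_tangent (theta : 'rV[R]_p.+1) (a : 'I_p.+1) (x : D) : R :=
  partial a (mode_term (set_val x)) theta.

Lemma mode_shift (r : nat) (q : 'rV[R]_(r * p.+1)) (i k : 'I_r) (a : 'I_p.+1)
    (h : R) :
  mode (h *: delta_mx 0 (mxvec_index i a) + q) k =
  (if k == i then h *: delta_mx 0 a else 0) + mode q k.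
Proof.
rewrite /mode linearD linearZ /= vec_mx_delta linearD linearZ /=.
congr (_ + _); apply/rowP => b; rewrite !mxE.
by case: eqP => _; rewrite ?mxE ?eqxx //= mulr0.
Qed.

(** Both sides are limits of difference quotients, and these quotients agree
    before the limit is taken, because the terms of the modes other than [i]
    cancel. *)
Lemma duhat_mxvec_index (r : nat) (q : 'rV[R]_(r * p.+1)) (i : 'I_r)
    (a : 'I_p.+1) :
  duhat (D := D) phi q (mxvec_index i a) = mode_tangent (mode q i) a.
Proof.
apply/funext => x; rewrite /duhat /mode_tangent /partial /derive.
apply: (congr1 (fun quotient : R -> R => lim (quotient @ 0^'))).
apply/funext => h /=; congr (_ *: _).
rewrite /uhat -sumrB (bigD1 i) //= big1 ?addr0 => [|k /negPf ki].
  by rewrite mode_shift eqxx.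
by rewrite mode_shift ki add0r subrr.
Qed.

End OneMode.

(** Names of the calculations: [inl] of a pair of parameters of a mode in
    nondecreasing order stands for G_ab, and [inr] of a parameter for h_a. *)
Definition calculation_index (K : nat) : finType :=
  ({ab : 'I_K * 'I_K | (ab.1 <= ab.2)%N} + 'I_K)%type.

(** Each [b] is the larger component of [b.+1] pairs, and these numbers add up
    to a triangular number. *)
Lemma card_ord_pairs_le (K : nat) :
  #|[pred ab : 'I_K * 'I_K | (ab.1 <= ab.2)%N]| = 'C(K.+1, 2).
Proof.
have row (b : 'I_K) : (\sum_(a < K | a <= b) 1 = b.+1)%N.
  rewrite -(big_ord_widen_cond _ xpredT (fun=> 1%N) (ltn_ord b)).
  by rewrite sum1_card card_ord.
rewrite -sum1_card.
rewrite -(pair_big_dep xpredT (fun a b : 'I_K => (a <= b)%N) (fun _ _ => 1%N)).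
rewrite (exchange_big_dep xpredT) //= (eq_bigr _ (fun b _ => row b)).
by rewrite -bin2_sum big_nat_recl // add0n big_mkord.
Qed.

Lemma card_calculation_index (K : nat) :
  #|calculation_index K| = (K * (K + 3) %/ 2)%N.
Proof.
rewrite card_sum card_sig card_ord_pairs_le card_ord bin2 /=.
rewrite -divn2 addnC -divnMDl //; congr (_ %/ 2)%N; lia.
Qed.

Section Calculations.
Context (R : realType) (d p : nat) (D : set 'rV[R]_d).
Context (H : hilbert_function_space R D).
Context (F : ('rV[R]_d -> R) -> (D -> R)).
Context (phi : 'rV[R]_d -> 'rV[R]_p -> R).

Definition calculation (t : calculation_index p.+1) : symbolic_calculation R p :=
  match t with
  | inl ab => SymMetric (val ab).1 (val ab).2 (fun theta theta' =>
      hfs_inner H (mode_tangent phi theta (val ab).1)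
                  (mode_tangent phi theta' (val ab).2))
  | inr a => SymRhs a (fun theta r q =>
      hfs_inner H (mode_tangent phi theta a) (F (uhat phi q)))
  end.

Lemma calculation_correct (t : calculation_index p.+1) :
  correct_calculation H F phi (calculation t).
Proof.
by case: t => [ab|a] r q i => [j|]; rewrite /= !duhat_mxvec_index.
Qed.

Lemma calculation_metric (r : nat) (i j : 'I_(r * p.+1)) :
  exists t, yields_metric_entry H phi (calculation t) i j.
Proof.
case/mxvec_indexP: i => k a; case/mxvec_indexP: j => l b.
case: (leqP a b) => [ab|/ltnW ba].
  exists (inl (exist _ (a, b) ab)), k, l => q.
  by rewrite mxE !duhat_mxvec_index.
(* Only G_ba has been calculated: the two modes are interchanged. *)
exists (inl (exist _ (b, a) ba)), l, k => q.
by rewrite mxE !duhat_mxvec_index /hfs_inner hfs_dotC.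
Qed.

Lemma calculation_rhs (r : nat) (i : 'I_(r * p.+1)) :
  exists t, yields_rhs_entry H F phi (calculation t) i.
Proof.
case/mxvec_indexP: i => k a; exists (inr a), k => q.
by rewrite mxE duhat_mxvec_index.
Qed.

End Calculations.

Theorem theorem1 (R : realType) (d p : nat) (D : set 'rV[R]_d)
    (H : hilbert_function_space R D)
    (F : ('rV[R]_d -> R) -> (D -> R))
    (phi : 'rV[R]_d -> 'rV[R]_p -> R)
    (F_diffop : differential_operator F)
    (phi_C1 : forall beta : 'rV[R]_p, C1 (fun x => phi x beta))
    (phi_diff : forall (x : 'rV[R]_d) (beta : 'rV[R]_p), differentiable (phi x) beta)
    (duhat_H : forall (r : nat) (q : 'rV[R]_(r * p.+1)) (i : 'I_(r * p.+1)),
       hfs_mem H (duhat (D := D) phi q i))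
    (F_uhat_H : forall (r : nat) (q : 'rV[R]_(r * p.+1)),
       hfs_mem H (F (uhat phi q))) :
  let K := p.+1 in
  exists c : 'I_(K * (K + 3) %/ 2) -> symbolic_calculation R p,
    (forall s, correct_calculation H F phi (c s)) /\
    forall r : nat,
      (forall i j : 'I_(r * K), exists s, yields_metric_entry H phi (c s) i j) /\
      (forall i : 'I_(r * K), exists s, yields_rhs_entry H F phi (c s) i).
Proof.
move=> K; set card := card_calculation_index K.
pose name s := enum_val (cast_ord (esym card) s).
have nameK t : name (cast_ord card (enum_rank t)) = t.
  by rewrite /name cast_ordK enum_rankK.
exists (fun s => calculation H F phi (name s)).
split=> [s|r]; first exact: calculation_correct.
split=> [i j|i].
  have [t tij] := calculation_metric H F phi i j.
  by exists (cast_ord card (enum_rank t)); rewrite nameK.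
have [t ti] := calculation_rhs H F phi i.
by exists (cast_ord card (enum_rank t)); rewrite nameK.
Qed.
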